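(* For every positive integer $n$ divisible by $6$, there exist an $n$-dimensional acyclic unique sink orientation (AUSO) $\psi$ of the hypercube $Q^n$, a starting vertex $v_0\in Q^n$, and a tie-breaking rule given by a fixed ordered list $T$ of the $2n$ directions, such that Zadeh's least-entered rule with tie-breaking list $T$, started at $v_0$, takes a path of length at least $2^{n/6}$ (i.e. makes at least $2^{n/6}$ steps) before reaching the global sink of $\psi$.
   Context: The $n$-dimensional hypercube $Q^n$ has vertex set $2^{[n]}$, with $u,v$ adjacent iff $|u\oplus v|=1$; the edge between $v$ and $v\oplus\{j\}$ is on coordinate $j$. A face is $F(C,v)=\{u: u\oplus v\subseteq C\}$. A unique sink orientation (USO) is an orientation of the edges of $Q^n$ such that every nonempty face has exactly one sink (vertex with no outgoing edges inside the face); an AUSO is an acyclic USO; the global sink is the unique vertex with no outgoing edges. A direction is a signed coordinate $\pm c$, $c\in[n]$; at $v$, $+c$ refers to the edge to $v\cup\{c\}$ ($c\notin v$) and $-c$ to the edge to $v\setminus\{c\}$ ($c\in v$); it is available at $v$ if that edge exists and is outgoing from $v$. Zadeh's least-entered rule: maintain for each of the $2n$ directions $d$ a count $h(d)$ of how many times $d$ has been used so far (initially all $0$). At each step, if the current vertex is not the global sink, among the available directions choose one minimizing $h(d)$; if several minimize $h$, choose the one appearing first in the fixed ordered list $T$; move along it and increment its count. *)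

(* Defs.v *)
From mathcomp Require Import all_boot.
Set Implicit Arguments. Unset Strict Implicit. Unset Printing Implicit Defensive.

Notation vertex n := {set 'I_n}.

Definition flip n (v : vertex n) (j : 'I_n) : vertex n :=
  if j \in v then v :\ j else j |: v.

(* An orientation: [out v j] means the edge between v and flip v j on
   coordinate j is directed away from v. *)
Definition orientation n := vertex n -> 'I_n -> bool.

Definition is_orientation n (o : orientation n) : Prop :=
  forall v j, o (flip v j) j = ~~ o v j.

Definition face n (C v : vertex n) : {set vertex n} :=
  [set u | (u :\: v) :|: (v :\: u) \subset C].

Definition sink_in n (o : orientation n) (C u : vertex n) : bool :=
  [forall j in C, ~~ o u j].

Definition is_USO n (o : orientation n) : Prop :=
  is_orientation o /\
  forall C v : vertex n, #|[set u in face C v | sink_in o C u]| = 1.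

Definition arc n (o : orientation n) : rel (vertex n) :=
  fun u w => [exists j, (w == flip u j) && o u j].

Definition acyclic n (o : orientation n) : Prop :=
  forall u w, arc o u w -> ~~ connect (arc o) w u.

Definition is_AUSO n (o : orientation n) : Prop := is_USO o /\ acyclic o.

Definition global_sink n (o : orientation n) (v : vertex n) : bool :=
  [forall j, ~~ o v j].

(* Directions: (c, true) = +c, (c, false) = -c. *)
Notation direction n := (prod (ordinal n) bool).

Definition available n (o : orientation n) (v : vertex n) (d : direction n) : bool :=
  (if d.2 then d.1 \notin v else d.1 \in v) && o v d.1.

Definition move n (v : vertex n) (d : direction n) : vertex n :=
  if d.2 then d.1 |: v else v :\ d.1.

Definition tie_list n (T : seq (direction n)) : Prop :=
  perm_eq T (enum [set: direction n]).

Definition zadeh_choice n (o : orientation n) (T : seq (direction n))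
    (h : direction n -> nat) (v : vertex n) : option (direction n) :=
  foldl (fun acc d =>
           if available o v d then
             match acc with
             | None => Some d
             | Some b => if h d < h b then Some d else acc
             end
           else acc) None T.

Definition zadeh_step n (o : orientation n) (T : seq (direction n))
    (s : vertex n * (direction n -> nat)) : vertex n * (direction n -> nat) :=
  let (v, h) := s in
  if global_sink o v then s else
  match zadeh_choice o T h v with
  | None => s
  | Some d => (move v d, fun d' => h d' + (d' == d))
  end.

Definition zadeh_state n (o : orientation n) (T : seq (direction n))
    (v0 : vertex n) (k : nat) : vertex n * (direction n -> nat) :=
  iter k (zadeh_step o T) (v0, fun _ => 0).

(* Main.v *)
Require Import Defs.
From mathcomp Require Import all_boot zify.
Set Implicit Arguments. Unset Strict Implicit. Unset Printing Implicit Defensive.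

(** Group the coordinates into triples and double the length of the run with
    each triple, adversarially: for every start vertex, and every history
    that uses the coordinates of each triple about equally, there is an AUSO on which the rule runs for long.  Pick the triple
    [g] whose coordinates have been used most, let [o1] be the AUSO obtained
    inductively on the other triples for the current history, and place over
    each vertex of this frame an orientation of the 3-cube spanned by [g], all
    of them with the same sink [t].  The layer [t] is then a hypersink, so it
    may carry any AUSO [o2].  The orientations of the 3-cubes are chosen along
    the run so that the moves inside them only keep the use counts of [g] level
    with the largest counts of the frame, without ever reaching [t], until the
    frame has reached the sink of [o1].  Then [t] is entered, and [o2] is the
    AUSO obtained inductively for the vertex and the history reached by then:
    the frame is traversed a second time.

    Since the uses of [+j] and [-j] alternate, the history is determined by the
    numbers [T j] of moves along each coordinate, and the rule chooses the
    available coordinate that minimizes [(T j)./2], ties being broken by the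
    index. *)

(** * Flips and restrictions of vertices *)

Lemma in_flip n (v : vertex n) (j i : 'I_n) :
  (i \in flip v j) = (i \in v) (+) (i == j).
Proof.
by rewrite /flip; case: (boolP (j \in v)) => jv; rewrite !inE;
  case: eqP => [->|_]; rewrite ?jv ?(negbTE jv) ?addbF //.
Qed.

Lemma flip_setI_in n (v S : vertex n) (j : 'I_n) :
  j \in S -> flip v j :&: S = flip (v :&: S) j.
Proof.
move=> jS; apply/setP=> i; rewrite !(inE, in_flip).
by case: eqP => [->|_]; rewrite ?jS ?addbF ?andbT.
Qed.

Lemma flip_setI_out n (v S : vertex n) (j : 'I_n) :
  j \notin S -> flip v j :&: S = v :&: S.
Proof.
move=> jS; apply/setP=> i; rewrite !(inE, in_flip).
by case: eqP => [->|_]; rewrite ?(negbTE jS) ?addbF ?andbF.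
Qed.

(** * Runs of the least-entered rule on coordinates *)

Section Run.

Variable n : nat.
Implicit Types (o : orientation n) (v : vertex n) (T : 'I_n -> nat).
Implicit Types ds : seq 'I_n.

(** Since [j < n], keys compare the halved counts first and then the indices. *)
Definition key T (j : 'I_n) := (T j)./2 * n + j.

Definition count_up T ds := fun i => T i + count_mem i ds.

Fixpoint run o v T ds : bool :=
  if ds is d :: ds' then
    [&& o v d, [forall i, o v i ==> (key T d <= key T i)]
      & run o (flip v d) (count_up T [:: d]) ds']
  else true.

Lemma eq_run_in (S : {set 'I_n}) o v T1 T2 ds :
    (forall v j, o v j -> j \in S) -> {in S, T1 =1 T2} ->
  run o v T1 ds = run o v T2 ds.
Proof.
move=> oS; elim: ds v T1 T2 => //= d ds IH v T1 T2 eqT.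
have [ovd|//] := boolP (o v d); rewrite /=; congr (_ && _).
  apply/forallP/forallP=> H i; have := H i; case: (boolP (o v i)) => //= ovi;
    by rewrite /key !eqT ?(oS _ _ ovi) ?(oS _ _ ovd).
by apply: IH => i iS; rewrite /count_up eqT.
Qed.

Lemma eq_run o v T1 T2 ds : T1 =1 T2 -> run o v T1 ds = run o v T2 ds.
Proof. by move=> eqT; apply: (@eq_run_in setT) => [? ?|? _]; rewrite ?inE. Qed.

Lemma count_up_cat T ds es : count_up T (ds ++ es) =1 count_up (count_up T ds) es.
Proof. by move=> i; rewrite /count_up count_cat addnA. Qed.

Lemma run_cat o v T ds es :
  run o v T (ds ++ es) =
  run o v T ds && run o (foldl (@flip n) v ds) (count_up T ds) es.
Proof.
elim: ds v T => [|d ds IH] v T /=.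
  by apply: eq_run => i; rewrite /count_up addn0.
rewrite IH -!andbA; congr [&& _, _, _ & _].
by apply: eq_run => i; rewrite -(count_up_cat T [:: d] ds).
Qed.

(* Outmaps differ on the span of any two vertices (the Szabo-Welzl
   condition), and a rank decreases along every edge. *)
Definition auso_on (S : {set 'I_n}) o : Prop :=
  [/\ forall v j, o v j -> j \in S,
      forall u v : vertex n, u \subset S -> v \subset S -> u != v ->
        exists2 j, (j \in u) != (j \in v) & o u j != o v j
    & exists r : vertex n -> nat,
        forall (v : vertex n) j, v \subset S -> o v j -> r (flip v j) < r v].

Lemma run_sub S o v T ds :
  auso_on S o -> run o v T ds -> {subset ds <= S}.
Proof.
case=> oS _ _; elim: ds v T => //= d ds IH v T /and3P[/oS dS _ /IH dsS] i.
by rewrite inE => /orP[/eqP-> //|/dsS].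
Qed.

End Run.

Section Auso.
Variable n : nat.
Implicit Types o : orientation n.

(** A vertex of least rank in a face is a sink of it; a second sink would contradict the Szabo-Welzl
    condition. That condition on adjacent vertices also makes both ends of an edge agree, and the
    rank excludes cycles. *)
Lemma auso_onT o : auso_on [set: 'I_n] o -> is_AUSO o.
Proof.
case=> _ sep [r rP]; split; first split.
- move=> v j; have [|i] := sep (flip v j) v (subsetT _) (subsetT _).
    by apply/eqP=> /setP/(_ j); rewrite in_flip eqxx addbT; case: (j \in v).
  rewrite in_flip; have [->|_] := eqVneq i j; last by rewrite addbF eqxx.
  by move=> _; case: (o _ j); case: (o v j).
- move=> C v; apply/eqP/cards1P.
  have vF : v \in face C v by rewrite inE setDv setU0 sub0set.
  case: (arg_minnP r vF) => u uF umin; exists u.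
  have faceP w : (w \in face C v) -> forall j, j \notin C -> (j \in w) = (j \in v).
    rewrite inE => /subsetP wC j jC; move: (contraNN (@wC j) jC).
    by rewrite !inE; case: (j \in w); case: (j \in v).
  have faceF w j : w \in face C v -> j \in C -> flip w j \in face C v.
    move=> wF jC; rewrite inE; apply/subsetP=> i.
    have [-> //|ij] := eqVneq i j.
    have [//|iC] := boolP (i \in C).
    by rewrite !inE in_flip (negbTE ij) addbF (faceP _ wF _ iC); case: (i \in v).
  have usink : sink_in o C u.
    apply/forall_inP=> j jC; apply/negP=> ouj.
    by move: (umin _ (faceF _ _ uF jC)); rewrite leqNgt rP ?subsetT.
  apply/setP=> w; rewrite !inE; apply/andP/eqP => [[wF wsink]|->]; last first.
    by split => //; have : u \in face C v by []; rewrite inE.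
  have {}wF : w \in face C v by rewrite inE.
  apply/eqP; have [//|/sep] := eqVneq w u.
  case=> [||j]; rewrite ?subsetT // => dj.
  have jC : j \in C.
    by apply: contraNT dj => jC; rewrite (faceP _ wF _ jC) (faceP _ uF _ jC).
  by rewrite (negbTE (forall_inP wsink _ jC)) (negbTE (forall_inP usink _ jC)).
have rc u w : connect (Defs.arc o) u w -> r w <= r u.
  case/connectP=> p; elim: p u => [|x p IH] u /=; first by move=> _ ->.
  case/andP=> /existsP[j /andP[/eqP-> ouj]] /IH{}IH /IH /leq_trans; apply.
  by rewrite ltnW // rP ?subsetT.
move=> u w /existsP[j /andP[/eqP-> ouj]]; apply/negP=> /rc.
by rewrite leqNgt rP ?subsetT.
Qed.

End Auso.

(** * From coordinates back to directions *)

Section Zadeh.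
Variable n : nat.
Implicit Types (o : orientation n) (v : vertex n) (T : 'I_n -> nat).
Implicit Types (h : direction n -> nat) (s : seq (direction n)).

Definition dirs (r : seq 'I_n) : seq (direction n) :=
  [seq (j, b) | j <- r, b <- [:: true; false]].

Lemma tie_list_dirs : tie_list (dirs (enum 'I_n)).
Proof.
apply: uniq_perm; last first.
- by case=> j b; rewrite mem_enum inE; apply/allpairsP; exists (j, b); split;
    rewrite ?mem_enum // !inE; case: b.
- by rewrite enum_uniq.
- by apply: allpairs_uniq; rewrite ?enum_uniq // => -[? ?] [? ?].
Qed.

Lemma dirs_cat r1 r2 : dirs (r1 ++ r2) = dirs r1 ++ dirs r2.
Proof. by rewrite /dirs map_cat flatten_cat. Qed.

Lemma dirs_cons j r : dirs (j :: r) = [:: (j, true), (j, false) & dirs r].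
Proof. by []. Qed.

(** The fold replaces its candidate only by a strictly better one, hence the strict bound before [d]
    and the weak one after it. *)
Lemma zadeh_choice_cat o h v s1 d s2 :
    available o v d ->
    {in s1, forall c, available o v c -> h d < h c} ->
    {in s2, forall c, available o v c -> h d <= h c} ->
  zadeh_choice o (s1 ++ d :: s2) h v = Some d.
Proof.
move=> ad lt1 le2; rewrite /zadeh_choice foldl_cat /= ad.
have lt_acc : if foldl (fun acc c => if available o v c then
    if acc is Some b then if h c < h b then Some c else acc else Some c
    else acc) None s1 is Some b then h d < h b else true.
  elim/last_ind: s1 lt1 => // s1 c IH lt1; rewrite foldl_rcons.
  have : {in s1, forall c, available o v c -> h d < h c}.
    by move=> x xs; apply: lt1; rewrite mem_rcons inE xs orbT.
  move=> /IH{IH}; case: foldl => [b|]; case: ifP => // ac hb.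
    by case: ifP => // _; apply: lt1; rewrite ?mem_rcons ?inE ?eqxx.
  by apply: lt1; rewrite ?mem_rcons ?inE ?eqxx.
have -> : (if foldl (fun acc c => if available o v c then
    if acc is Some b then if h c < h b then Some c else acc else Some c
    else acc) None s1 is Some b then
    if h d < h b then Some d else
    foldl (fun acc c => if available o v c then
    if acc is Some b then if h c < h b then Some c else acc else Some c
    else acc) None s1 else Some d) = Some d.
  by case: foldl lt_acc => // b ->.
elim: s2 le2 => //= c s2 IH le2.
case: ifP => [ac|_]; last by apply: IH => x xs; apply: le2; rewrite inE xs orbT.
rewrite ltnNge le2 ?inE ?eqxx //=.
by apply: IH => x xs; apply: le2; rewrite inE xs orbT.
Qed.

(* Since the uses of [+j] and [-j] alternate, after [T j] uses of coordinate
   [j] the direction currently usable has been used [(T j)./2] times. *)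
Definition tracks h v T := forall j b, h (j, b) =
  if b == (j \notin v) then (T j)./2 else uphalf (T j).

Lemma zadeh_choice_run o v T h d :
    tracks h v T -> o v d -> [forall i, o v i ==> (key T d <= key T i)] ->
  zadeh_choice o (dirs (enum 'I_n)) h v = Some (d, d \notin v).
Proof.
move=> tr ovd /forallP min_d.
have hE i b : available o v (i, b) -> (b == (i \notin v)) /\ o v i.
  by rewrite /available /=; case: b; case: (i \in v).
have le_d i : o v i -> (T d)./2 <= (T i)./2.
  move=> ovi; have /implyP/(_ ovi) := min_d i; rewrite /key.
  by have := ltn_ord i; have := ltn_ord d; nia.
have lt_d (i : 'I_n) : o v i -> i < d -> (T d)./2 < (T i)./2.
  move=> ovi ltid; have /implyP/(_ ovi) := min_d i; rewrite /key.
  by have := ltn_ord i; have := ltn_ord d; nia.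
have [r1 [r2 eq_enum]] : exists r1 r2, enum 'I_n = r1 ++ d :: r2.
  by case/splitPr: (mem_enum 'I_n d) => r1 r2; exists r1, r2.
have lt_r1 : {in r1, forall i : 'I_n, i < d}.
  move=> i ir1.
  have : sorted ltn (map val (enum 'I_n)) by rewrite val_enum_ord iota_ltn_sorted.
  rewrite eq_enum sorted_pairwise; last exact: ltn_trans.
  rewrite map_cat pairwise_cat => /andP[/allrelP lt12 _].
  by apply: lt12; rewrite map_f // inE eqxx.
have inD c r : c \in dirs r -> c.1 \in r.
  by case/allpairsP=> -[j b] [? _ ->].
have hd : h (d, d \notin v) = (T d)./2 by rewrite tr eqxx.
have lt1 : {in dirs r1, forall c, available o v c -> h (d, d \notin v) < h c}.
  case=> i b /inD/lt_r1 ltid /hE[/eqP-> ovi].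
  by rewrite hd tr eqxx lt_d.
have le2 : {in dirs r2, forall c, available o v c -> h (d, d \notin v) <= h c}.
  by case=> i b _ /hE[/eqP-> ovi]; rewrite hd tr eqxx le_d.
rewrite eq_enum dirs_cat dirs_cons; case: (boolP (d \in v)) hd lt1 le2 => dv hd lt1 le2.
  rewrite -cat1s catA.
  rewrite zadeh_choice_cat //= /available /= ?dv // => c.
  rewrite mem_cat inE => /orP[|/eqP->]; first exact: lt1.
  by rewrite /available /= dv.
rewrite zadeh_choice_cat //= /available /= ?dv // => c.
rewrite inE => /orP[/eqP->|]; last exact: le2.
by rewrite /available /= (negbTE dv).
Qed.

Lemma zadeh_run o v T h ds k :
    tracks h v T -> run o v T ds -> k < size ds ->
  ~~ global_sink o (iter k (zadeh_step o (dirs (enum 'I_n))) (v, h)).1.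
Proof.
elim: k ds v T h => [|k IH] [|d ds] v T h tr //= /and3P[ovd min_d rds] ltk.
  by apply/forallPn; exists d; rewrite negbK.
rewrite -iterS iterSr /=.
have -> : global_sink o v = false.
  by apply/negbTE/forallPn; exists d; rewrite negbK.
rewrite (zadeh_choice_run tr ovd min_d).
have -> : move v (d, d \notin v) = flip v d.
  by rewrite /move /flip /=; case: (d \in v).
apply: IH rds _ => // j b.
have -> : count_up T [:: d] j = T j + (j == d) by rewrite /count_up /= addn0 eq_sym.
rewrite tr in_flip xpair_eqE.
have [->|_] := eqVneq j d; last by rewrite addbF !addn0.
(* The direction just used reaches [uphalf (T d).+1]; the opposite one, at
   [uphalf (T d) = (T d).+1./2], becomes usable. *)
by rewrite addbT addn1 /= uphalfE; case: (d \in v); case: b; rewrite /= ?addn0 ?addn1.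
Qed.

End Zadeh.

(** * Orientations of the 3-cube *)

Definition bitn w i : bool := odd (w %/ 2 ^ i).

Definition toggle w i := if bitn w i then w - 2 ^ i else w + 2 ^ i.

(* Vertices of the 3-cube are numbers [w < 8], read in binary; the entry [w] of
   a table is the set of coordinates leaving [w].  These two AUSOs with sink 7,
   and the configurations below, were found by computer search. *)
Definition gadget (q : bool) : seq nat :=
  if q then [:: 5; 4; 7; 6; 2; 3; 1; 0] else [:: 1; 2; 3; 4; 6; 7; 5; 0].

Definition gadget_rank (q : bool) : seq nat :=
  if q then [:: 5; 4; 6; 5; 2; 3; 1; 0] else [:: 3; 2; 4; 1; 6; 7; 5; 0].

Definition gout q w i : bool := bitn (nth 0 (gadget q) w) i.

Definition grank q w := nth 0 (gadget_rank q) w.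

Lemma all_iota8 (P : pred nat) w : all P (iota 0 8) -> w < 8 -> P w.
Proof. by move=> /allP allP ltw; apply: allP; rewrite mem_iota. Qed.

Lemma gadget_sep q w1 w2 : w1 < 8 -> w2 < 8 -> w1 != w2 ->
  exists i, [/\ i < 3, bitn w1 i != bitn w2 i & gout q w1 i != gout q w2 i].
Proof.
pose P w1 w2 := (w1 != w2) ==>
  has (fun i => (bitn w1 i != bitn w2 i) && (gout q w1 i != gout q w2 i))
    (iota 0 3).
have chk : all (fun w1 => all (P w1) (iota 0 8)) (iota 0 8).
  by rewrite /P; case: (q); vm_compute.
move=> lt1 lt2 dw; have := all_iota8 (all_iota8 chk lt1) lt2.
rewrite /P dw => /hasP[i]; rewrite mem_iota => lti /andP[b s].
by exists i.
Qed.

Lemma gout7 q i : gout q 7 i = false.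
Proof. by case: q; rewrite /gout /bitn /= div0n. Qed.

Lemma grank_toggle q w i : w < 8 -> i < 3 -> gout q w i ->
  grank q (toggle w i) < grank q w.
Proof.
have chk : all (fun w => all (fun i =>
    gout q w i ==> (grank q (toggle w i) < grank q w)) (iota 0 3)) (iota 0 8).
  by case: q; vm_compute.
move=> ltw lti; have /allP/(_ i) := all_iota8 chk ltw.
by rewrite mem_iota => /(_ lti)/implyP.
Qed.

Lemma grank_lt q w : grank q w < 8.
Proof.
rewrite /grank; case: (ltnP w 8) => [ltw|lew].
  have chk : all (fun w => nth 0 (gadget_rank q) w < 8) (iota 0 8).
    by case: q; vm_compute.
  exact: all_iota8 chk ltw.
by rewrite nth_default //; case: q.
Qed.

(** This is [key] within one triple, with 3 in the role of [n]. *)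
Definition lex_le (off : seq nat) i j :=
  (nth 0 off i)./2 * 3 + i <= (nth 0 off j)./2 * 3 + j.

(* The rule inside a 3-cube, as long as it prefers the cube to the frame, i.e.
   as long as it finds a coordinate with use count below [lim]. *)
Fixpoint gpath lim q w off xs : bool :=
  if xs is x :: xs' then
    [&& x < 3, gout q w x, (nth 0 off x)./2 < lim,
        all (fun i => gout q w i ==> lex_le off x i) (iota 0 3)
      & gpath lim q (toggle w x) (incr_nth off x) xs']
  else true.

Lemma gpath_cons lim q w off x xs : gpath lim q w off (x :: xs) =
  [&& x < 3, gout q w x, (nth 0 off x)./2 < lim,
      all (fun i => gout q w i ==> lex_le off x i) (iota 0 3)
    & gpath lim q (toggle w x) (incr_nth off x) xs].
Proof. by []. Qed.

(** Executes the rule in the cube to propose a path, which [gpath] then certifies. *)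
Fixpoint gtrace fuel lim q w off : seq nat :=
  if fuel is f.+1 then
    if [seq i <- iota 0 3 | gout q w i && ((nth 0 off i)./2 < lim)] is i0 :: s
    then let x := foldl (fun x i => if lex_le off x i then x else i) i0 s in
      x :: gtrace f lim q (toggle w x) (incr_nth off x)
    else [::]
  else [::].

(* A configuration [(ph, w, off)] relative to a base [b] says that the run is at
   [w] with [T = 2 b + off] on the triple, while every frame
   coordinate satisfies the bound of [frame_traversal]. *)
Definition config : eqType := (bool * nat * seq nat)%type.

Definition configs : seq config :=
  [:: (false, 0, [:: 0; 0; 0]); (false, 2, [:: 0; 0; 0]);
      (true, 2, [:: 2; 2; 2]); (true, 5, [:: 1; 0; 1]);
      (true, 5, [:: 1; 1; 1]); (true, 6, [:: 2; 1; 1]);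
      (true, 6, [:: 2; 2; 1])].

(* A [Variant] rather than the bare membership test, which conversion would
   otherwise try to evaluate. *)
Variant config_spec ph w off : Prop :=
  ConfigSpec of (ph, w, off) \in configs.

(* Parities of [T] on a triple, up to an even constant, between two
   traversals. *)
Definition parities : seq (seq nat) :=
  [:: [:: 0; 0; 0]; [:: 1; 0; 1]; [:: 1; 1; 1]].

(* [hi] tells whether the frame coordinate about to be used attains the bound
   [2 b + 3] of phase [ph = true]; the base then becomes [b + 1]. *)
Lemma config_step ph w off (hi : bool) :
    config_spec ph w off -> (hi -> ph) ->
  exists q xs off', let w' := foldl toggle w xs in
  [/\ gpath 1 q w off xs, config_spec (~~ hi) w' off',
      forall i, i < 3 -> nth 0 off i + count_mem i xs = nth 0 off' i + hi.*2
    & forall i, i < 3 -> gout q w' i ->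
        0 < (nth 0 off i + count_mem i xs)./2].
Proof.
pose ok (c : config) hi q := let: (ph, w, off) := c in
  let xs := gtrace 8 1 q w off in let w' := foldl toggle w xs in
  let tot i := nth 0 off i + count_mem i xs in
  [&& gpath 1 q w off xs, (~~ hi, w', mkseq (fun i => tot i - hi.*2) 3) \in configs
   & all (fun i => (hi.*2 <= tot i) && (gout q w' i ==> (0 < (tot i)./2)))
      (iota 0 3)].
have chk : all (fun c : config =>
    all (fun hi : bool => (hi ==> c.1.1) ==> has (ok c hi) [:: false; true])
      [:: false; true]) configs by vm_compute.
case=> cin /implyP hiP; have /allP/(_ hi) := allP chk _ cin.
rewrite hiP => /(_ _)/hasP[|q _ /and3P[]]; first by case: (hi).
move: (gtrace _ _ _ _ _) => xs path in' /allP tot.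
exists q, xs, (mkseq (fun i => nth 0 off i + count_mem i xs - hi.*2) 3).
split; [exact: path | by constructor; exact: in' | | ] => i lti; have := tot i;
  clear -lti; rewrite mem_iota => /(_ lti)/andP[le imp].
  by rewrite nth_mkseq // subnK.
exact/implyP.
Qed.

(** With the frame at its sink nothing competes with the cube; the limit 9 exceeds every halved
    count met on the way to 7. *)
Lemma config_final ph w off : config_spec ph w off ->
  exists q xs r d, [/\ gpath 9 q w off xs, foldl toggle w xs = 7, r \in parities
    & forall i, i < 3 -> nth 0 off i + count_mem i xs = d.*2 + nth 0 r i].
Proof.
pose ok (c : config) q r d := let: (ph, w, off) := c in
  let xs := gtrace 8 9 q w off in
  [&& gpath 9 q w off xs, foldl toggle w xs == 7
   & all (fun i => nth 0 off i + count_mem i xs == d.*2 + nth 0 r i)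
      (iota 0 3)].
have chk : all (fun c : config => has (fun q => has (fun r => has (ok c q r)
    (iota 0 3)) parities) [:: false; true]) configs by vm_compute.
case=> /(allP chk)/hasP[q _ /hasP[r rin /hasP[d _ /and3P[path /eqP w7 /allP tot]]]].
exists q, (gtrace 8 9 q w off), r, d.
split; [exact: path | exact: w7 | exact: rin | ] => i lti; clear -lti tot.
by apply/eqP/tot; rewrite mem_iota.
Qed.

(** The mask can give the current vertex any code, so the starting configuration depends on the
    parities alone. *)
Lemma config_init r : r \in parities ->
  exists2 w, w < 7 & config_spec (nth 0 r 0 == 1) w r.
Proof.
rewrite !inE => /or3P[]/eqP->; [exists 0|exists 5|exists 5];
  by [|constructor].
Qed.

Lemma config_neq7 ph w off : config_spec ph w off -> w != 7.
Proof.
case; by move: w => [|[|[|[|[|[|[|[|w]]]]]]]]; rewrite // !inE /= !xpair_eqE; case: ph.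
Qed.

(** * Combining a frame orientation with orientations of 3-cubes *)

Section Fibre.

Variables (n' g : nat).
Let n := n'.+1.
Hypothesis ltg : 3 * g + 2 < n.
Variable mask : nat -> bool.
Implicit Types (u v : vertex n) (j : 'I_n) (T : 'I_n -> nat).

Definition coord g i : 'I_n := inord (3 * g + i).
Local Notation e := (coord g).

Lemma val_coord i : i < 3 -> e i = 3 * g + i :> nat.
Proof. by move=> lti; rewrite inordK //; move: ltg; lia. Qed.

Lemma coord_div i : i < 3 -> e i %/ 3 = g.
Proof. by move=> lti; rewrite val_coord //; lia. Qed.

Lemma coord_mod i : i < 3 -> e i %% 3 = i.
Proof. by move=> lti; rewrite val_coord //; lia. Qed.

Lemma coordK j : j %/ 3 = g -> e (j %% 3) = j.
Proof.
clear ltg; move=> <-; apply: val_inj.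
by rewrite /= inordK; have := ltn_ord j; lia.
Qed.

Lemma eq_coord i1 i2 : i1 < 3 -> i2 < 3 -> (e i1 == e i2) = (i1 == i2).
Proof.
move=> lt1 lt2; apply/eqP/eqP => [|-> //] /(congr1 (@nat_of_ord _)).
by rewrite !val_coord //; lia.
Qed.

(* [mask] reflects the cube so that the current vertex gets a given code. *)
Definition code v : nat :=
  let b i := (e i \in v) (+) mask i in b 0 + 2 * b 1 + 4 * b 2.

Lemma code_lt8 v : code v < 8.
Proof. by rewrite /code; do 3!case: (_ (+) _). Qed.

Lemma bitn_code v i : i < 3 -> bitn (code v) i = (e i \in v) (+) mask i.
Proof.
by case: i => [|[|[|]]] // _; rewrite /code; do 3!case: (_ (+) _).
Qed.

Lemma code_flip v i : i < 3 -> code (flip v (e i)) = toggle (code v) i.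
Proof.
move=> lti; rewrite /toggle bitn_code // /code !in_flip !eq_coord //.
by case: i lti => [|[|[|]]] // _ /=; rewrite ?addbF ?addbT ?addNb;
  do 3!case: (_ (+) _).
Qed.

Lemma code_flip_out v j : j %/ 3 != g -> code (flip v j) = code v.
Proof.
move=> dj; rewrite /code !in_flip.
have ne i : i < 3 -> (e i == j) = false.
  by move=> lti; apply: contraNF dj => /eqP<-; rewrite coord_div.
by rewrite !ne // !addbF.
Qed.

(* Code 7 is the hypersink. *)
Definition comb (S : {set 'I_n}) (C : vertex n -> bool) (o1 o2 : orientation n) :
    orientation n := fun v j =>
  if j %/ 3 == g then gout (C (v :&: S)) (code v) (j %% 3)
  else if code v == 7 then o2 (v :&: S) j else o1 (v :&: S) j.

Lemma comb_auso (S S' : {set 'I_n}) C o1 o2 :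
    (forall j, j \in S' = (j %/ 3 != g) && (j \in S)) ->
    (forall j, j %/ 3 = g -> j \in S) ->
  auso_on S' o1 -> auso_on S' o2 -> auso_on S (comb S' C o1 o2).
Proof.
move=> S'E gS [o1S sep1 [r1 r1P]] [o2S sep2 [r2 r2P]]; split.
- move=> v j; rewrite /comb; case: eqP => [/gS //|_].
  by case: ifP => _ => [/o2S|/o1S]; rewrite S'E => /andP[].
- move=> u v uS vS duv.
  have [eq_code|dcode] := eqVneq (code u) (code v); last first.
    have [eq_uv|duv'] := eqVneq (u :&: S') (v :&: S').
      have [i [lti b s]] := gadget_sep (C (u :&: S')) (code_lt8 u) (code_lt8 v) dcode.
      exists (e i); first by apply: contraNneq b => b; rewrite !bitn_code // b.
      by rewrite /comb coord_div // eqxx coord_mod // -eq_uv.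
    (* Both gadgets have an empty outmap at 7, so if one code is 7, the gadget over the other vertex
       separates the two. *)
    have [u7|u7] := eqVneq (code u) 7; last have [v7|v7] := eqVneq (code v) 7.
    + have [i [lti b s]] :=
        gadget_sep (C (v :&: S')) (code_lt8 u) (code_lt8 v) dcode.
      exists (e i); first by apply: contraNneq b => b; rewrite !bitn_code // b.
      rewrite /comb coord_div // eqxx coord_mod //.
      by move: s; rewrite u7 !gout7.
    + have [i [lti b s]] :=
        gadget_sep (C (u :&: S')) (code_lt8 u) (code_lt8 v) dcode.
      exists (e i); first by apply: contraNneq b => b; rewrite !bitn_code // b.
      rewrite /comb coord_div // eqxx coord_mod //.
      by move: s; rewrite v7 !gout7.
    have [||j dj so] := sep1 _ _ _ _ duv'; rewrite ?subsetIr //.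
    have jS' : j \in S' by move: dj; rewrite !inE; case: (j \in S'); rewrite // !andbF.
    exists j; first by move: dj; rewrite !inE jS' !andbT.
    move: jS'; rewrite S'E => /andP[/negbTE dg _].
    by rewrite /comb dg (negbTE u7) (negbTE v7).
  have duv' : u :&: S' != v :&: S'.
    apply: contraNneq duv => /setP eq_uv; apply/eqP/setP => j.
    have := eq_uv j; rewrite !inE S'E.
    have [jg _|_] := eqVneq (j %/ 3) g.
      rewrite -(coordK jg); have lti : j %% 3 < 3 by rewrite ltn_mod.
      by apply: (@addIb (mask (j %% 3))); rewrite -!bitn_code // eq_code.
    have [_|jS _] := boolP (j \in S); first by rewrite !andbT.
    by rewrite (contraNF (subsetP uS j)) // (contraNF (subsetP vS j)).
  have sep12 : exists2 j, (j \in u :&: S') != (j \in v :&: S') &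
      (if code u == 7 then o2 (u :&: S') j else o1 (u :&: S') j) !=
      (if code u == 7 then o2 (v :&: S') j else o1 (v :&: S') j).
    by case: (code u == 7); [apply: sep2 | apply: sep1]; rewrite ?subsetIr.
  have [j dj so] := sep12.
  have jS' : j \in S' by move: dj; rewrite !inE; case: (j \in S'); rewrite // !andbF.
  exists j; first by move: dj; rewrite !inE jS' !andbT.
  by move: jS'; rewrite S'E => /andP[/negbTE dg _]; rewrite /comb dg -eq_code.
(* [M] puts layer 7 below all others. Elsewhere the frame rank dominates, its weight 8 exceeding
   every [grank], because a frame move may change the gadget. *)
pose M := (\max_(u : vertex n) r2 u).+1.
exists (fun v => if code v == 7 then r2 (v :&: S')
                 else M + (r1 (v :&: S') * 8 + grank (C (v :&: S')) (code v))).
move=> v j vS; rewrite /comb; case: (eqVneq (j %/ 3) g) => [jg|dj].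
  have lti : j %% 3 < 3 by rewrite ltn_mod.
  have jS' : j \notin S' by rewrite S'E jg eqxx.
  have [->|v7] := eqVneq (code v) 7; first by rewrite gout7.
  have -> : code (flip v j) = toggle (code v) (j %% 3).
    by rewrite -code_flip // coordK.
  rewrite flip_setI_out // => go.
  have := grank_toggle (code_lt8 v) lti go.
  case: ifP => _; last by rewrite ltn_add2l ltn_add2l.
  by rewrite ltnS => _; apply: leq_trans (leq_addr _ _); apply: leq_bigmax.
rewrite code_flip_out //; case: ifP => _ ovj.
  by rewrite flip_setI_in ?r2P ?subsetIr //; apply: o2S ovj.
rewrite flip_setI_in; last by apply: o1S ovj.
have := r1P _ _ (subsetIr _ _) ovj.
by have := grank_lt (C (flip (v :&: S') j)) (code v); rewrite /M; lia.
Qed.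

End Fibre.

(** * Arithmetic of keys and use counts *)

Lemma key_le n (T : 'I_n -> nat) (i j : 'I_n) :
  (key T i <= key T j) = ((T i)./2 < (T j)./2 + (i <= j)).
Proof.
rewrite /key; have := ltn_ord i; have := ltn_ord j.
move: (T i)./2 (T j)./2 => x y ltj lti.
have [lexy|ltyx|->] := ltngtP x y.
- have : x.+1 * n <= y * n by rewrite leq_mul.
  by rewrite mulSn; case: (i <= j); lia.
- have : y.+1 * n <= x * n by rewrite leq_mul.
  by rewrite mulSn; case: (i <= j); lia.
- by rewrite leq_add2l; case: leqP; lia.
Qed.

(** A least-key frame coordinate also has the least threshold [(T j)./2 + (g < j %/ 3)] against the
    triple [g]. *)
Lemma key_le_shift n (T : 'I_n -> nat) g (i j : 'I_n) : key T i <= key T j ->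
  (T i)./2 + (g < i %/ 3) <= (T j)./2 + (g < j %/ 3).
Proof.
rewrite key_le; have [leij|ltji] := leqP i j.
  rewrite addn1 ltnS => leT; apply: leq_add => //.
  by case: ltnP => // lti; rewrite (leq_trans lti) // leq_div2r.
by rewrite addn0 => ltT; case: (g < i %/ 3); rewrite ?addn1 ?addn0;
  apply: leq_trans (leq_addr _ _) => //; apply: ltnW.
Qed.

(** These bounds serve the invariant of the frame traversal: [t] is the count of a frame coordinate
    [j], [x] is [g < j %/ 3], and [y] below is [t + x.*2]. *)
Lemma half_le_succ t b (x ph : bool) :
  t + x.*2 <= b.*2 + 2 + ph -> t./2 + x <= b.+1.
Proof. by case: x; case: ph; lia. Qed.

Lemma bound_quiet t b (x ph : bool) :
  t./2 + x <= b -> t + 1 + x.*2 <= b.*2 + 2 + ph.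
Proof. by case: x; case: ph; lia. Qed.

Lemma bound_raise b (hi : bool) : (b + hi).*2 + 2 + ~~ hi = b.*2 + 3 + hi.
Proof. by case: hi; lia. Qed.

Lemma bound_moved t b (x ph : bool) : t + x.*2 <= b.*2 + 2 + ph ->
  t + 1 + x.*2 <= b.*2 + 3 + (t + x.*2 == b.*2 + 3).
Proof. by case: eqP; case: ph; lia. Qed.

Lemma bound_still y b (hi ph : bool) :
  y <= b.*2 + 2 + ph -> y <= b.*2 + 3 + hi.
Proof. by case: hi; case: ph; lia. Qed.

Lemma gpath_lt3 lim q w off xs : gpath lim q w off xs -> {in xs, forall x, x < 3}.
Proof.
elim: xs w off => //= x xs IH w off /and5P[ltx _ _ _ /IH{}IH] y.
by rewrite inE => /orP[/eqP->|/IH].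
Qed.

(** * Runs in the combined orientation *)

Section FibreRun.

Variables (n' g : nat).
Let n := n'.+1.
Hypothesis ltg : 3 * g + 2 < n.
Implicit Types (mask : nat -> bool) (u v : vertex n) (j : 'I_n) (T : 'I_n -> nat).
Local Notation e := (@coord n' g).

Lemma code_unmask v w : w < 8 -> code g (fun i => (e i \in v) (+) bitn w i) v = w.
Proof.
rewrite /code => ltw; rewrite !addKb.
by move: w ltw => [|[|[|[|[|[|[|[|w]]]]]]]].
Qed.

Lemma count_coord i xs : i < 3 -> {in xs, forall x, x < 3} ->
  count_mem (e i) (map e xs) = count_mem i xs.
Proof.
move=> lti ltxs; rewrite count_map; apply: eq_in_count => x xin /=.
by rewrite eq_coord // ltxs.
Qed.

Section Frame.

Variables (S : {set 'I_n}) (o1 : orientation n) (r1 : vertex n -> nat).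
Hypothesis gS : forall j, j \in S -> (j %/ 3 == g) = false.
Hypothesis o1S : forall v j, o1 v j -> j \in S.
Hypothesis r1P : forall v j, v \subset S -> o1 v j -> r1 (flip v j) < r1 v.

Lemma coord_notin i : i < 3 -> e i \notin S.
Proof. by move=> lti; apply/negP=> /gS; rewrite coord_div // eqxx. Qed.

Lemma count_coord_in j xs : j \in S -> {in xs, forall x, x < 3} ->
  count_mem j (map e xs) = 0.
Proof.
move=> jS ltxs; apply/count_memPn/mapP => -[x /ltxs ltx ej].
by move: jS; rewrite ej (negbTE (coord_notin ltx)).
Qed.

Lemma coord_lt i j : i < 3 -> j \in S -> (e i <= j) = (g < j %/ 3).
Proof. by move=> lti /gS; rewrite val_coord //; lia. Qed.

Lemma le_coord i j : i < 3 -> j \in S -> (j <= e i) = ~~ (g < j %/ 3).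
Proof. by move=> lti /gS; rewrite val_coord //; lia. Qed.

(** The even base shifts all halved counts by exactly [b], so comparisons in the cube are those of
    [gpath]; the last hypothesis keeps the frame behind halved counts below [b + lim]. *)
Lemma fibre_run mask C o2 xs v T b off lim :
    gpath lim (C (v :&: S)) (code g mask v) off xs ->
    (forall i, i < 3 -> T (e i) = b.*2 + nth 0 off i) ->
    (forall j, o1 (v :&: S) j -> b + lim <= (T j)./2 + (g < j %/ 3)) ->
  let v' := foldl (@flip n) v (map e xs) in
  [/\ run (comb g mask S C o1 o2) v T (map e xs),
      code g mask v' = foldl toggle (code g mask v) xs & v' :&: S = v :&: S].
Proof.
elim: xs v T off => [|x xs IH] v T off; first by [].
rewrite gpath_cons => /and5P[ltx gx ltlim /allP min_x path] Te Tlim /=.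
have code7 : (code g mask v == 7) = false.
  by apply: contraTF gx => /eqP->; rewrite gout7.
have vS : flip v (e x) :&: S = v :&: S by rewrite flip_setI_out ?coord_notin.
have [|i lti|j oj|run' code' S'] := IH (flip v (e x)) (count_up T [:: e x]) (incr_nth off x).
- by rewrite vS code_flip.
- by rewrite /count_up /= Te // nth_incr_nth eq_coord //; lia.
- rewrite vS in oj; rewrite /count_up /= addn0.
  have -> : (e x == j) = false.
    by apply: contraNF (coord_notin ltx) => /eqP->; apply: o1S oj.
  by rewrite addn0 Tlim.
rewrite code_flip // vS in code' S' *; split=> //.
rewrite run' andbT {1}/comb coord_div // eqxx coord_mod // gx /=.
apply/forallP=> j; apply/implyP; rewrite /comb code7.
case: eqP => [jg|/eqP jg].
  have ltj : j %% 3 < 3 by rewrite ltn_mod.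
  move: (coordK jg) ltj; move: (j %% 3) => i <- lti gi.
  have := min_x i; rewrite mem_iota => /(_ lti)/implyP/(_ gi).
  rewrite /lex_le => lex; rewrite key_le.
  by rewrite !Te // !val_coord //; move: lex; lia.
move=> oj; rewrite key_le Te // coord_lt ?(o1S oj) //.
by have := Tlim _ oj; move: ltlim; lia.
Qed.

Lemma frame_step mask C o2 v T d :
    code g mask v != 7 -> o1 (v :&: S) d ->
    [forall j, o1 (v :&: S) j ==> (key T d <= key T j)] ->
    (forall i, i < 3 -> gout (C (v :&: S)) (code g mask v) i ->
       (T d)./2 + (g < d %/ 3) <= (T (e i))./2) ->
  comb g mask S C o1 o2 v d &&
  [forall j, comb g mask S C o1 o2 v j ==> (key T d <= key T j)].
Proof.
move=> /negbTE code7 od /forallP min_d le_g.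
have dS := o1S od; rewrite {1}/comb gS // code7 od /=.
apply/forallP=> j; apply/implyP; rewrite /comb code7.
case: eqP => [jg|_ oj]; last exact: implyP (min_d j) oj.
have ltj : j %% 3 < 3 by rewrite ltn_mod.
move: (coordK jg) ltj; move: (j %% 3) => i <- lti /(le_g _ lti) le_di.
by rewrite key_le le_coord //; move: le_di; case: (g < _); lia.
Qed.

Lemma sink_fibre_run mask C (o2 : orientation n) v T ds :
    (forall v j, o2 v j -> j \in S) -> code g mask v = 7 ->
    run o2 (v :&: S) T ds ->
  let v' := foldl (@flip n) v ds in
  [/\ run (comb g mask S C o1 o2) v T ds, code g mask v' = 7
    & v' :&: S = foldl (@flip n) (v :&: S) ds].
Proof.
move=> o2S; elim: ds v T => [|d ds IH] v T //= v7 /and3P[od /forallP min_d rds].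
have dS := o2S _ _ od.
have vS : flip v d :&: S = flip (v :&: S) d by rewrite flip_setI_in.
have [||run' code' S'] := IH (flip v d) (count_up T [:: d]); rewrite ?vS //.
  by rewrite code_flip_out // gS.
rewrite vS in S'; split=> //; rewrite run' andbT {1}/comb gS // v7 eqxx od /=.
apply/forallP=> j; rewrite /comb v7 eqxx gout7.
by case: eqP => // _; apply: min_d.
Qed.

(* A coordinate of the triple is preferred to a frame coordinate [j] iff its use
   count is less than [(T j)./2 + (g < j %/ 3)], hence the shift by
   [(g < j %/ 3).*2] in the bound on [T j].  Only the values of [C] at vertices
   of rank at most that of the start matter for the run, which is what allows
   [C] to be chosen step by step. *)
Lemma frame_traversal mask ds1 v T b ph off :
    config_spec ph (code g mask v) off ->
    (forall i, i < 3 -> T (e i) = b.*2 + nth 0 off i) ->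
    {in S, forall j, T j + (g < j %/ 3).*2 <= b.*2 + 2 + ph} ->
    run o1 (v :&: S) T ds1 ->
    (forall j, ~~ o1 (foldl (@flip n) (v :&: S) ds1) j) ->
  exists C0 ds, let v' := foldl (@flip n) v ds in
  [/\ forall C o2,
        (forall u, r1 u <= r1 (v :&: S) -> C u = C0 u) ->
        run (comb g mask S C o1 o2) v T ds,
      code g mask v' = 7 /\ v' :&: S = foldl (@flip n) (v :&: S) ds1,
      {in S, forall j, count_mem j ds = count_mem j ds1},
      exists d r, r \in parities /\ forall i, i < 3 ->
        T (e i) + count_mem (e i) ds = d.*2 + nth 0 r i
    & size ds1 < size ds].
Proof.
elim: ds1 v T b ph off => [|d ds1 IH] v T b ph off cin Te TS.
  move=> _ sink1; have [q [xs [r [k [path w7 rin tot]]]]] := config_final cin.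
  have ltxs := gpath_lt3 path.
  have frun C o2 : C (v :&: S) = q -> _ := fun Cq =>
    @fibre_run mask C o2 xs v T b off 9 (etrans (congr1 (fun q => gpath 9 q _ _ _) Cq) path)
    Te (fun j oj => False_ind _ (negP (sink1 j) oj)).
  exists (fun _ => q), (map e xs); split.
  - by move=> C o2 Cq; case: (frun C o2); rewrite ?Cq.
  - by case: (frun (fun _ => q) o1 erefl) => _ -> ->.
  - by move=> j jS; rewrite count_coord_in.
  - exists (b + k), r; split=> // i lti.
    by rewrite Te // count_coord // -addnA tot // doubleD addnA.
  - rewrite size_map; case: (xs) w7 => //= w7.
    by move: (config_neq7 cin); rewrite w7.
rewrite [run _ _ _ _]/= => /and3P[od min_d rds1] sink1.
have dS := o1S od.
have ned i : i < 3 -> (d == e i) = false.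
  by move=> lti; apply: contraTF dS => /eqP->; apply: coord_notin.
have r1d : r1 (flip (v :&: S) d) < r1 (v :&: S) by rewrite r1P ?subsetIr.
(* If the threshold of [d] is at most [b], the triple, with halved counts at least [b], does not
   precede it, and the frame moves at once. *)
have := TS d dS; have [leb|ltb] := leqP ((T d)./2 + (g < d %/ 3)) b => leY.
  have vS : flip v d :&: S = flip (v :&: S) d by rewrite flip_setI_in.
  have [||||j|C0 [ds]] := IH (flip v d) (count_up T [:: d]) b ph off;
    rewrite ?vS //.
  - by rewrite code_flip_out ?gS.
  - by move=> i lti; rewrite /count_up /= ned // !addn0 Te.
  - move=> j jS; rewrite /count_up /= addn0.
    by have [<-|_] := eqVneq d j; [apply: bound_quiet | rewrite addn0 TS].
  move=> /= [runC [code7 endS] cnt [k [r [rin tot]]] sz].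
  exists C0, (d :: ds); split=> //=.
  - move=> C o2 CC0; rewrite andbA frame_step //=; last 1 first.
    + move=> i lti _; rewrite Te // halfD odd_double doubleK add0n.
      exact: leq_trans leb (leq_addr _ _).
    + by apply: runC => u ler; apply: CC0; rewrite (leq_trans ler) // ltnW.
    + exact: config_neq7 cin.
  - by move=> j jS; rewrite cnt.
  - exists k, r; split=> // i lti; rewrite -tot // /count_up /= ned //.
    by rewrite !add0n addn0.
(* Now the threshold of [d] is [b + 1]: the triple moves until its outgoing coordinates have halved
   counts at least [b + 1]. *)
pose hi := T d + (g < d %/ 3).*2 == b.*2 + 3.
have hiP : hi -> ph by rewrite /hi => /eqP; move: leY; case: (ph) => //; lia.
have [q [xs [off' [path cin' off'E lev]]]] := config_step cin hiP.
have ltxs := gpath_lt3 path.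
pose v1 := foldl (@flip n) v (map e xs).
pose T2 := count_up (count_up T (map e xs)) [:: d].
have frun C o2 : C (v :&: S) = q ->
  [/\ run (comb g mask S C o1 o2) v T (map e xs),
      code g mask v1 = foldl toggle (code g mask v) xs & v1 :&: S = v :&: S].
  move=> Cq; apply: fibre_run Te _; first by rewrite Cq; apply: path.
  move=> j oj; have := implyP (forallP min_d j) oj.
  by move=> /(key_le_shift g); apply: leq_trans; rewrite addn1.
have [_ code1 v1S] := frun (fun _ => q) o1 erefl.
have vS : flip v1 d :&: S = flip (v :&: S) d by rewrite flip_setI_in // v1S.
have T1S j : j \in S -> count_up T (map e xs) j = T j.
  by move=> jS; rewrite /count_up count_coord_in // addn0.
have T1e i : i < 3 -> count_up T (map e xs) (e i) =
    b.*2 + (nth 0 off i + count_mem i xs).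
  by move=> lti; rewrite /count_up count_coord // Te // addnA.
have [|||||C0 [ds]] := IH (flip v1 d) T2 (b + hi) (~~ hi) off'; rewrite ?vS //.
- by rewrite code_flip_out ?gS // code1.
- move=> i lti; rewrite /T2 {1}/count_up T1e // off'E //= ned //.
  by rewrite !addn0 doubleD addnAC addnA.
- move=> j jS; rewrite /T2 {1}/count_up T1S //= addn0.
  rewrite bound_raise; have [<-|_] := eqVneq d j; first exact: bound_moved leY.
  by rewrite addn0; apply: bound_still (TS j jS).
- by rewrite -(@eq_run_in _ S _ _ (count_up T [:: d])) // => j jS;
    rewrite /T2 {1 2}/count_up T1S.
move=> /= [runC [code7 endS] cnt [k [r [rin tot]]] sz].
(* The frame rank drops along [d], so fixing [q] over the current frame vertex does not disturb the
   gadgets chosen later. *)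
exists (fun u => if u == v :&: S then q else C0 u), (map e xs ++ d :: ds).
split=> /=.
- move=> C o2 CC0; have Cq : C (v :&: S) = q by rewrite CC0 ?eqxx.
  have [runx _ _] := frun C o2 Cq; rewrite run_cat runx /= -/v1.
  rewrite andbA frame_step ?v1S //=.
  + apply: runC => u ler; rewrite CC0; last by rewrite (leq_trans ler) // ltnW.
    by case: eqP ler r1d => // ->; rewrite leqNgt => /negbTE->.
  + by rewrite code1; apply: config_neq7 cin'.
  + apply/forallP=> j; apply/implyP=> oj; rewrite /key !T1S ?(o1S oj) //.
    exact: implyP (forallP min_d j) oj.
  + move=> i lti; rewrite Cq code1 T1e // T1S // => /(lev _ lti) pos.
    rewrite halfD odd_double doubleK add0n.
    by rewrite (leq_trans (half_le_succ leY)) // -addn1 leq_add2l.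
- by rewrite foldl_cat /= -/v1; split.
- by move=> j jS; rewrite count_cat count_coord_in //= cnt.
- exists k, r; split=> // i lti; rewrite -tot // /T2 /count_up count_cat /= ned //.
  by rewrite !add0n !addn0 addnA.
- by rewrite size_cat /= addnS ltnS (leq_trans _ (leq_addl _ _)).
Qed.

End Frame.
End FibreRun.

(** * Doubling *)

Lemma seq_argmax (I : eqType) (f : I -> nat) (s : seq I) : s != [::] ->
  exists2 x, x \in s & {in s, forall y, f y <= f x}.
Proof.
elim: s => // x [|y s] IH _.
  by exists x; rewrite ?inE // => y; rewrite inE => /eqP->.
have [//|z zin zmax] := IH.
have [lexz|/ltnW lezx] := leqP (f x) (f z).
  exists z; first by rewrite inE zin orbT.
  by move=> t; rewrite inE => /orP[/eqP->|/zmax].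
exists x; rewrite ?inE ?eqxx // => t; rewrite inE => /orP[/eqP-> //|/zmax le].
exact: leq_trans le lezx.
Qed.

Section Main.

Variable n' : nat.
Let n := n'.+1.
Implicit Types (G : seq nat) (v : vertex n) (T : 'I_n -> nat).

Definition span G : {set 'I_n} := [set j : 'I_n | j %/ 3 \in G].

Definition synced T g := exists b r,
  r \in parities /\ forall i, i < 3 -> T (@coord n' g i) = b.*2 + nth 0 r i.

Lemma eq_synced T1 T2 g : (forall i, i < 3 -> T1 (@coord n' g i) = T2 (coord n' g i)) ->
  synced T1 g -> synced T2 g.
Proof.
by move=> eqT [b [r [rin Tr]]]; exists b, r; split=> // i lti; rewrite -eqT ?Tr.
Qed.

(** Every list in [parities] has its maximum at index 0. *)
Lemma synced_max T (j : 'I_n) : synced T (j %/ 3) -> T j <= T (coord n' (j %/ 3) 0).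
Proof.
case=> b [r [rin Tr]].
rewrite -{1}(coordK (erefl (j %/ 3))) !Tr ?ltn_mod // leq_add2l.
have : j %% 3 < 3 by rewrite ltn_mod.
by move: (j %% 3) rin => [|[|[|]]] //; rewrite !inE => /or3P[]/eqP->.
Qed.

(** The final counts must again be synced, since the second traversal starts from those left by the
    first. *)
Lemma long_run G v T :
    uniq G -> {in G, forall g, 3 * g + 2 < n} -> v \subset span G ->
    {in G, forall g, synced T g} ->
  exists (o : orientation n) ds,
  [/\ auso_on (span G) o, run o v T ds,
      forall j, ~~ o (foldl (@flip n) v ds) j,
      2 ^ size G <= (size ds).+1
    & {in G, forall g, synced (count_up T ds) g}].
Proof.
move: {2}(size G) (erefl (size G)) => m.
elim: m G v T => [|m IH] G v T.
  move/size0nil=> -> _ _ _ _; exists (fun _ _ => false), [::]; split=> //.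
  split=> //; last by exists (fun _ => 0).
  have -> : span [::] = set0 by apply/setP=> j; rewrite !inE.
  by move=> u w; rewrite !subset0 => /eqP-> /eqP->; rewrite eqxx.
move=> szG uniqG ltG vG syncG.
have [|g gG gmax] := seq_argmax (fun g => T (coord n' g 0)) (s := G).
  by case: (G) szG.
have ltg := ltG g gG.
pose G' := rem g G.
have G'E h : (h \in G') = (h != g) && (h \in G) by rewrite mem_rem_uniq // inE.
have szG' : size G' = m by rewrite size_rem // szG.
have uniqG' : uniq G' by rewrite rem_uniq.
have ltG' : {in G', forall h, 3 * h + 2 < n}.
  by move=> h; rewrite G'E => /andP[_ /ltG].
have SE (j : 'I_n) : j \in span G' = (j %/ 3 != g) && (j \in span G).
  by rewrite !inE G'E.
have gS (j : 'I_n) : j \in span G' -> (j %/ 3 == g) = false.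
  by rewrite SE => /andP[/negbTE].
have coordS h i : h \in G' -> i < 3 -> coord n' h i \in span G'.
  by move=> hG' lti; rewrite inE coord_div // ltG'.
have [o1 [ds1 [auso1 run1 sink1 len1 sync1]]] :=
  IH G' (v :&: span G') T szG' uniqG' ltG' (subsetIr _ _)
    (fun h => fun hG' => syncG h (mem_rem hG')).
have [o1S _ [r1 r1P]] := auso1.
have [b [r [rin Tr]]] := syncG g gG.
have [w ltw cfg] := config_init rin.
pose mask i := (coord n' g i \in v) (+) bitn w i.
have codev : code g mask v = w by apply: code_unmask; apply: ltnW.
(* As [g] is the most used triple, [T j <= b.*2 + nth 0 r 0], which leaves room 2 for the shift. *)
have bound : {in span G', forall j : 'I_n,
    T j + (g < j %/ 3).*2 <= b.*2 + 2 + (nth 0 r 0 == 1)}.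
  move=> j jS; have jG : j %/ 3 \in G by move: jS; rewrite SE inE => /andP[].
  have := leq_trans (synced_max (syncG _ jG)) (gmax _ jG); rewrite Tr //.
  have : nth 0 r 0 = (nth 0 r 0 == 1) by move: rin; rewrite !inE => /or3P[]/eqP->.
  by move: (_ == 1) => ph ->; case: (g < _); move: (T j) ph => t [] /=; lia.
rewrite -codev in cfg.
have [C [ds [runC [code7 endS] cnt syncg sz]]] :=
  frame_traversal ltg gS o1S r1P cfg Tr bound run1 sink1.
set v1 := foldl _ v ds in code7 endS.
pose T1 := count_up T ds.
have sync1' : {in G', forall h, synced T1 h}.
  move=> h hG'; apply: eq_synced (sync1 h hG') => i lti.
  by rewrite /T1 /count_up cnt // coordS.
have [o2 [ds2 [auso2 run2 sink2 len2 sync2]]] :=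
  IH G' (v1 :&: span G') T1 szG' uniqG' ltG' (subsetIr _ _) sync1'.
have [o2S _ _] := auso2.
have [runC2 code7' endS'] := sink_fibre_run ltg o1 gS C o2S code7 run2.
have gin (j : 'I_n) : j %/ 3 = g -> j \in span G by move=> jg; rewrite inE jg.
exists (comb g mask (span G') C o1 o2), (ds ++ ds2); split.
- exact: comb_auso.
- by rewrite run_cat runC //= -/v1.
- move=> j; rewrite foldl_cat -/v1 /comb code7' eqxx gout7.
  by case: eqP => // _; rewrite endS'.
(* Since [size ds1 < size ds], [(size ds1).+1 + (size ds2).+1] is at most
   [(size ds + size ds2).+1]. *)
- rewrite szG expnS mul2n -addnn size_cat -addnS.
  rewrite szG' in len1 len2.
  by apply: leq_add len2; apply: leq_trans len1 _.
- move=> h hG; have [->|nhg] := eqVneq h g.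
    case: syncg => d [r' [rin' tot]]; exists d, r'; split=> // i lti.
    rewrite count_up_cat /count_up tot //.
    rewrite (count_memPn _) ?addn0 //; apply/negP=> /(run_sub auso2 run2)/gS.
    by rewrite coord_div // eqxx.
  apply: eq_synced (sync2 h _) => [i lti|]; first by rewrite count_up_cat.
  by rewrite G'E nhg.
Qed.

End Main.

Theorem theorem8 (n : nat) :
  0 < n -> 6 %| n ->
  exists (psi : orientation n) (v0 : vertex n) (T : seq (direction n)),
    [/\ is_AUSO psi, tie_list T &
        forall k, k < 2 ^ (n %/ 6) ->
          ~~ global_sink psi (zadeh_state psi T v0 k).1].
Proof.
case: n => // n' _ /dvdnP[m def_n].
have [||||o [ds [auso_o run_o _ len _]]] :=
  @long_run n' (iota 0 (2 * m)) set0 (fun _ => 0).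
- exact: iota_uniq.
- by move=> g; rewrite mem_iota def_n; lia.
- exact: sub0set.
- by move=> g _; exists 0, [:: 0; 0; 0]; split=> // [[|[|[|]]]].
have spanT : span n' (iota 0 (2 * m)) = setT.
  by apply/setP=> j; rewrite !inE mem_iota /=; have := ltn_ord j; lia.
rewrite spanT in auso_o; exists o, set0, (dirs (enum 'I_n'.+1)).
split; [exact: auso_onT | exact: tie_list_dirs |] => k ltk.
apply: (@zadeh_run _ _ _ (fun _ => 0) _ ds) => //.
  by move=> j b; case: ifP.
have m_gt0 : 0 < m by case: (m) def_n.
have eq_m : n'.+1 %/ 6 = m by rewrite def_n mulnK.
(* The [2 * m] triples give [(2 ^ m) * (2 ^ m) <= (size ds).+1]; as [2 ^ m >= 2], this yields
   [2 ^ m <= size ds]. *)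
apply: leq_trans ltk _; move: len; rewrite eq_m size_iota mul2n -addnn expnD.
have : 2 ^ 1 <= 2 ^ m by rewrite leq_exp2l.
by move: (2 ^ m) (size ds) => x y; nia.
Qed.
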